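(* Let $C$ be a small category with an initial object $\emptyset$, let $P$ be a complete cd-structure on $C$ and let $F$ be a presheaf of sets on $C$ such that $F(\emptyset)=*$ (a one-point set) and for any distinguished square $Q$, with vertices $B,Y,A,X$ and sides $B\to Y$, $B\to A$, $p:Y\to X$, $e:A\to X$, the square of sets $$F(Q)=\left(\begin{array}{ccc}F(X)&\to&F(Y)\\ \downarrow&&\downarrow\\ F(A)&\to&F(B)\end{array}\right)$$ is a pull-back square. Then $F$ is a sheaf in the associated topology $t_P$.
   Context: Let $C$ be a small category with an initial object $\emptyset$. A cd-structure $P$ on $C$ is a class of commutative squares $Q$ with vertices $B,Y,A,X$ and sides $B\to Y$, $B\to A$, $p:Y\to X$, $e:A\to X$, closed under isomorphism of squares; its elements are called distinguished squares. The associated topology $t_P$ is the smallest Grothendieck topology on $C$ such that the empty sieve covers $\emptyset$ and, for every distinguished square, the sieve $(p,e)$ on $X$ generated by $p$ and $e$ is a covering sieve. The class $S_P$ of simple coverings is the smallest class of families $\{U_i\to X\}_{i\in I}$ such that (1) every family consisting of one isomorphism is in $S_P$; (2) if $Q\in P$ and $\{p_i:Y_i\to Y\}_{i\in I}$, $\{q_j:A_j\to A\}_{j\in J}$ are in $S_P$, then $\{p\circ p_i, e\circ q_j\}_{i\in I,j\in J}$ is in $S_P$. $P$ is complete if every $t_P$-covering sieve of an object $X$ not isomorphic to $\emptyset$ contains the sieve generated by a simple covering. *)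

(* Defs.v *)
Set Implicit Arguments.
Unset Strict Implicit.
Unset Printing Implicit Defensive.

Declare Scope cat_scope.
Delimit Scope cat_scope with cat.
Local Open Scope cat_scope.

Local Obligation Tactic := idtac.

Reserved Notation "f ∘ g" (at level 40, left associativity).

Record category : Type := Category {
  obj :> Type;
  hom : obj -> obj -> Type;
  idm : forall X, hom X X;
  comp : forall X Y Z, hom Y Z -> hom X Y -> hom X Z;
  comp_idl : forall X Y (f : hom X Y), comp (idm Y) f = f;
  comp_idr : forall X Y (f : hom X Y), comp f (idm X) = f;
  comp_assoc : forall W X Y Z (f : hom Y Z) (g : hom X Y) (h : hom W X),
    comp f (comp g h) = comp (comp f g) h
}.

Arguments hom {c} _ _.
Arguments idm {c} X.
Arguments comp {c X Y Z} _ _.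

Notation "f ∘ g" := (comp f g) : cat_scope.

Definition is_singleton (T : Type) : Prop := exists x : T, forall y : T, y = x.

Definition is_initial (C : category) (X : C) : Prop :=
  forall Y : C, is_singleton (hom X Y).

Definition is_iso (C : category) (X Y : C) (f : hom X Y) : Prop :=
  exists g : hom Y X, g ∘ f = idm X /\ f ∘ g = idm Y.

Definition isomorphic (C : category) (X Y : C) : Prop :=
  exists f : hom X Y, is_iso f.

(** ** Sieves and Grothendieck topologies *)

Record sieve (C : category) (X : C) : Type := Sieve {
  in_sieve :> forall Y : C, hom Y X -> Prop;
  sieve_closed : forall (Y Z : C) (f : hom Y X) (g : hom Z Y),
    in_sieve f -> in_sieve (f ∘ g)
}.

Arguments in_sieve {C X} _ {Y} _.

Definition sub_sieve (C : category) (X : C) (S T : sieve X) : Prop :=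
  forall (Y : C) (f : hom Y X), S Y f -> T Y f.

Program Definition empty_sieve (C : category) (X : C) : sieve X :=
  {| in_sieve := fun _ _ => False |}.
Next Obligation. now intros. Qed.

Program Definition pullback_sieve (C : category) (X Y : C)
    (f : hom Y X) (S : sieve X) : sieve Y :=
  {| in_sieve := fun Z g => S Z (f ∘ g) |}.
Next Obligation.
intros C X Y f S Z W g h Hg; simpl in *; rewrite comp_assoc; now apply sieve_closed.
Qed.

(* The first axiom is stated for every [S] containing all arrows, and not just
   for one maximal sieve, so that it does not depend on an extensionality
   principle for sieves. *)
Record is_topology (C : category) (J : forall X : C, sieve X -> Prop) : Prop :=
  IsTopology {
    topology_max : forall (X : C) (S : sieve X),
      (forall (Y : C) (f : hom Y X), S Y f) -> J X S;
    topology_pullback : forall (X Y : C) (f : hom Y X) (S : sieve X),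
      J X S -> J Y (pullback_sieve f S);
    topology_local : forall (X : C) (S T : sieve X),
      J X S ->
      (forall (Y : C) (f : hom Y X), S Y f -> J Y (pullback_sieve f T)) ->
      J X T
  }.

Record topology (C : category) : Type := Topology {
  covers :> forall X : C, sieve X -> Prop;
  topologyP : is_topology covers
}.

Arguments covers {C} _ {X} _.

(** ** Presheaves and sheaves of sets *)

Record presheaf (C : category) : Type := Presheaf {
  sections :> C -> Type;
  restr : forall X Y : C, hom Y X -> sections X -> sections Y;
  restr_id : forall (X : C) (x : sections X), restr (idm X) x = x;
  restr_comp : forall (X Y Z : C) (f : hom Y X) (g : hom Z Y) (x : sections X),
    restr (f ∘ g) x = restr g (restr f x)
}.

Arguments restr {C} _ {X Y} _ _.

Definition matching (C : category) (F : presheaf C) (X : C) (S : sieve X)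
    (s : forall (Y : C) (f : hom Y X), S Y f -> F Y) : Prop :=
  forall (Y Z : C) (f : hom Y X) (g : hom Z Y)
         (Hf : S Y f) (Hfg : S Z (f ∘ g)),
    restr F g (s Y f Hf) = s Z (f ∘ g) Hfg.

Definition amalgamation (C : category) (F : presheaf C) (X : C) (S : sieve X)
    (s : forall (Y : C) (f : hom Y X), S Y f -> F Y) (x : F X) : Prop :=
  forall (Y : C) (f : hom Y X) (Hf : S Y f), restr F f x = s Y f Hf.

Definition is_sheaf (C : category) (J : topology C) (F : presheaf C) : Prop :=
  forall (X : C) (S : sieve X), covers J S ->
  forall s : forall (Y : C) (f : hom Y X), S Y f -> F Y,
    matching s -> exists! x : F X, amalgamation s x.

(* The square  X --y--> Y
               |a       |b
               A --c--> B   is a pull-back square of sets. *)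
Definition is_pullback (X Y A B : Type)
    (y : X -> Y) (a : X -> A) (b : Y -> B) (c : A -> B) : Prop :=
  (forall x : X, b (y x) = c (a x)) /\
  forall (T : Type) (u : T -> Y) (v : T -> A),
    (forall t : T, b (u t) = c (v t)) ->
    exists! h : T -> X,
      (forall t : T, y (h t) = u t) /\ (forall t : T, a (h t) = v t).

(** ** cd-structures *)

(*  B --by--> Y
    |ba       |p
    A --e---> X  *)
Record square (C : category) : Type := Square {
  sqB : C;
  sqY : C;
  sqA : C;
  sqX : C;
  sq_by : hom sqB sqY;
  sq_ba : hom sqB sqA;
  sq_p : hom sqY sqX;
  sq_e : hom sqA sqX;
  sq_comm : sq_p ∘ sq_by = sq_e ∘ sq_ba
}.

Definition square_iso (C : category) (Q Q' : square C) : Prop :=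
  exists (fB : hom (sqB Q) (sqB Q')) (fY : hom (sqY Q) (sqY Q'))
         (fA : hom (sqA Q) (sqA Q')) (fX : hom (sqX Q) (sqX Q')),
    (is_iso fB /\ is_iso fY /\ is_iso fA /\ is_iso fX) /\
    (fY ∘ sq_by Q = sq_by Q' ∘ fB /\ fA ∘ sq_ba Q = sq_ba Q' ∘ fB /\
     fX ∘ sq_p Q = sq_p Q' ∘ fY /\ fX ∘ sq_e Q = sq_e Q' ∘ fA).

Record cd_structure (C : category) : Type := CdStructure {
  distinguished :> square C -> Prop;
  distinguished_iso : forall Q Q' : square C,
    square_iso Q Q' -> distinguished Q -> distinguished Q'
}.

Record family (C : category) (X : C) : Type := Family {
  idx : Type;
  dom : idx -> C;
  arr : forall i : idx, hom (dom i) X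
}.

Arguments dom {C X} _ _.
Arguments arr {C X} _ _.

Definition single_family (C : category) (X Y : C) (f : hom Y X) : family X :=
  {| idx := unit; dom := fun _ => Y; arr := fun _ => f |}.

Definition sum_family (C : category) (X : C) (U V : family X) : family X :=
  {| idx := (idx U + idx V)%type;
     dom := fun k => match k with inl i => dom U i | inr j => dom V j end;
     arr := fun k => match k with inl i => arr U i | inr j => arr V j end |}.

Definition comp_family (C : category) (X Y : C) (f : hom Y X) (U : family Y) :
    family X :=
  {| idx := idx U; dom := dom U; arr := fun i => f ∘ arr U i |}.

Program Definition generated_sieve (C : category) (X : C) (U : family X) :
    sieve X :=
  {| in_sieve := fun Y f =>
       exists (i : idx U) (g : hom Y (dom U i)), f = arr U i ∘ g |}.
Next Obligation.
intros C X U Y Z f g [i [h Hh]].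
exists i, (h ∘ g); rewrite Hh; symmetry; apply comp_assoc.
Qed.

Definition square_sieve (C : category) (Q : square C) : sieve (sqX Q) :=
  generated_sieve (sum_family (single_family (sq_p Q)) (single_family (sq_e Q))).

Section CdTopology.

Variables (C : category) (o : C) (P : cd_structure C).

Definition cd_covers (X : C) (S : sieve X) : Prop :=
  forall J : topology C,
    covers J (empty_sieve o) ->
    (forall Q : square C, P Q -> covers J (square_sieve Q)) ->
    covers J S.

Lemma cd_covers_topology : is_topology cd_covers.
Proof.
split.
- intros X S H J _ _; exact (topology_max (topologyP J) H).
- intros X Y f S H J Ho HQ.
  exact (topology_pullback (topologyP J) f (H J Ho HQ)).
- intros X S T HS HT J Ho HQ.
  apply (topology_local (topologyP J) (S := S)); [exact (HS J Ho HQ)|].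
  intros Y f Hf; exact (HT Y f Hf J Ho HQ).
Qed.

Definition cd_topology : topology C := Topology cd_covers_topology.

Inductive simple_covering : forall X : C, family X -> Prop :=
| simple_iso (X Y : C) (f : hom Y X) :
    is_iso f -> simple_covering (single_family f)
| simple_square (Q : square C) (U : family (sqY Q)) (V : family (sqA Q)) :
    P Q -> simple_covering U -> simple_covering V ->
    simple_covering
      (sum_family (comp_family (sq_p Q) U) (comp_family (sq_e Q) V)).

Definition complete : Prop :=
  forall (X : C) (S : sieve X),
    ~ isomorphic X o -> covers cd_topology S ->
    exists U : family X, simple_covering U /\ sub_sieve (generated_sieve U) S.

End CdTopology.

(* Main.v *)
(** Simple coverings are [t_P]-covering.  Completeness reduces separatedness of
    [F] on an object not isomorphic to the initial one to simple coverings, where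
    it follows by induction from the injectivity of [F(X) -> F(Y) * F(A)].
    Gluing along a simple covering is again an induction: the sections obtained
    over [Y] and [A] agree on a covering sieve of [B], hence on [B] by
    separatedness, and the pull-back property glues them over [X].  Finally a
    section glued along a simple covering contained in a covering sieve [S] is an
    amalgamation over all of [S], once more by separatedness. *)

From Stdlib Require Import Classical.
Require Import Defs.

Local Open Scope cat_scope.

(** * Covering sieves of an arbitrary topology *)

Section Topology.

Context {C : category} (J : topology C).

Lemma covers_sub {X : C} (S T : sieve X) :
  covers J S -> sub_sieve S T -> covers J T.
Proof.
intros HS HST.
apply (topology_local (topologyP J) (S := S)); [exact HS|].
intros Y f Hf; apply (topology_max (topologyP J)).
intros Z g; simpl; apply HST; now apply sieve_closed.
Qed.

Lemma covers_pullback {X Y : C} (f : hom Y X) (S : sieve X) :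
  covers J S -> covers J (pullback_sieve f S).
Proof. apply (topology_pullback (topologyP J)). Qed.

Definition meet_sieve {X : C} (S T : sieve X) : sieve X :=
  {| in_sieve := fun Y f => S Y f /\ T Y f;
     sieve_closed := fun Y Z f g H =>
       conj (sieve_closed g (proj1 H)) (sieve_closed g (proj2 H)) |}.

(** Pulled back along an arrow of [S], the meet contains the pullback of [T], so the local axiom
    applies. *)
Lemma covers_meet {X : C} (S T : sieve X) :
  covers J S -> covers J T -> covers J (meet_sieve S T).
Proof.
intros HS HT.
apply (topology_local (topologyP J) (S := S)); [exact HS|].
intros Y f Hf; apply covers_sub with (pullback_sieve f T).
- now apply covers_pullback.
- intros Z g Hg; split; [now apply sieve_closed | exact Hg].
Qed.

End Topology.

(** * Matching families and pull-backs of sets *)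

Section MatchingFamilies.

Context {C : category} (F : presheaf C).

(** Restricting along [idm Y] sends both sections to the entry of [s] at [f ∘ idm Y] with one and
    the same membership proof; this stands in for proof irrelevance. *)
Lemma matching_irrelevant {X : C} (S : sieve X)
    (s : forall (Y : C) (f : hom Y X), S Y f -> F Y) :
  matching s -> forall (Y : C) (f f' : hom Y X) (Hf : S Y f) (Hf' : S Y f'),
  f = f' -> s Y f Hf = s Y f' Hf'.
Proof.
intros Hs Y f f' Hf Hf' <-.
rewrite <- (restr_id (s Y f Hf)), <- (restr_id (s Y f Hf')).
now rewrite !(Hs _ _ _ _ _ (sieve_closed (idm Y) Hf)).
Qed.

Lemma matching_pullback {X Y : C} (h : hom Y X) (S : sieve X)
    (s : forall (Z : C) (f : hom Z X), S Z f -> F Z) :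
  matching s ->
  @matching C F Y (pullback_sieve h S) (fun Z f Hf => s Z (h ∘ f) Hf).
Proof.
intros Hs Z W f g Hf Hfg; simpl in *.
rewrite (Hs _ _ _ _ _ (sieve_closed g Hf)).
apply matching_irrelevant; [exact Hs | symmetry; apply comp_assoc].
Qed.

(** Points are maps from [unit]: the constant maps at [x] and [x'] induce the same cone, so
    uniqueness identifies them. *)
Lemma pullback_jointly_injective {X Y A B : Type} (y : X -> Y) (a : X -> A)
    (b : Y -> B) (c : A -> B) :
  is_pullback y a b c ->
  forall x x' : X, y x = y x' -> a x = a x' -> x = x'.
Proof.
intros [Hc Hu] x x' Hy Ha.
destruct (Hu unit (fun _ => y x) (fun _ => a x) (fun _ => Hc x)) as [h [_ Hh]].
rewrite <- (f_equal (fun k => k tt) (Hh (fun _ => x) ltac:(now split))).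
now rewrite <- (f_equal (fun k => k tt) (Hh (fun _ => x') ltac:(now split))).
Qed.

Lemma pullback_glue {X Y A B : Type} (y : X -> Y) (a : X -> A)
    (b : Y -> B) (c : A -> B) :
  is_pullback y a b c ->
  forall (u : Y) (v : A), b u = c v -> exists x : X, y x = u /\ a x = v.
Proof.
intros [_ Hu] u v Huv.
destruct (Hu unit (fun _ => u) (fun _ => v) (fun _ => Huv)) as [h [[Hy Ha] _]].
now exists (h tt); split.
Qed.

End MatchingFamilies.

(** * Simple coverings, separatedness and gluing *)

Section CdSheaf.

Context {C : category} {o : C} {P : cd_structure C} {F : presheaf C}.

Lemma covers_square_sieve (Q : square C) :
  P Q -> covers (cd_topology o P) (square_sieve Q).
Proof. intros HQ J _ HJ; now apply HJ. Qed.

Lemma simple_covering_covers {X : C} (U : family X) :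
  simple_covering P U -> covers (cd_topology o P) (generated_sieve U).
Proof.
induction 1 as [X Y f [g [_ Hfg]] | Q U V HQ _ IHU _ IHV].
- apply (topology_max (topologyP (cd_topology o P))); intros Z h.
  exists tt, (g ∘ h); simpl.
  now rewrite comp_assoc, Hfg, comp_idl.
- apply (topology_local (topologyP (cd_topology o P)) (S := square_sieve Q)).
  + now apply covers_square_sieve.
  (* An arrow of the square sieve factors through [p] or [e] by some [g]; the covering of [Y] or [A]
     given by induction is pulled back along [g]. *)
  + intros Z f [[[]|[]] [g Hg]]; simpl in g, Hg.
    * apply covers_sub with (pullback_sieve g (generated_sieve U)).
      { now apply covers_pullback. }
      intros W h [i [k Hk]]; exists (inl i), k; simpl.
      now rewrite Hg, <- !comp_assoc, Hk.
    * apply covers_sub with (pullback_sieve g (generated_sieve V)).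
      { now apply covers_pullback. }
      intros W h [j [k Hk]]; exists (inr j), k; simpl.
      now rewrite Hg, <- !comp_assoc, Hk.
Qed.

Lemma empty_sieve_covers_isomorphic {X : C} :
  isomorphic X o -> covers (cd_topology o P) (empty_sieve X).
Proof.
intros [f _]; apply covers_sub with (pullback_sieve f (empty_sieve o)).
- apply covers_pullback; intros J Ho _; exact Ho.
- now intros Y g Hg.
Qed.

Lemma singleton_isomorphic {X : C} :
  is_singleton (F o) -> isomorphic X o -> is_singleton (F X).
Proof.
intros [z Hz] [f [g [Hgf _]]]; exists (restr F f z); intros x.
rewrite <- (restr_id x), <- Hgf, restr_comp.
f_equal; apply Hz.
Qed.

Context (hP : complete o P) (hFo : is_singleton (F o))
  (hFQ : forall Q : square C, P Q ->
     is_pullback (restr F (sq_p Q)) (restr F (sq_e Q))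
                 (restr F (sq_by Q)) (restr F (sq_ba Q))).

Lemma simple_covering_separated {X : C} (U : family X) :
  simple_covering P U -> forall x y : F X,
  (forall i : idx U, restr F (arr U i) x = restr F (arr U i) y) -> x = y.
Proof.
induction 1 as [X Y f [g [_ Hfg]] | Q U V HQ _ IHU _ IHV]; intros x y Hxy.
- rewrite <- (restr_id x), <- (restr_id y), <- Hfg, !restr_comp.
  f_equal; exact (Hxy tt).
- apply (pullback_jointly_injective _ _ _ _ (hFQ Q HQ)).
  + apply IHU; intros i; rewrite <- !restr_comp; exact (Hxy (inl i)).
  + apply IHV; intros j; rewrite <- !restr_comp; exact (Hxy (inr j)).
Qed.

(** Completeness says nothing about objects isomorphic to [o]; there [F X] is a single point. *)
Lemma covers_separated {X : C} (S : sieve X) :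
  covers (cd_topology o P) S -> forall x y : F X,
  (forall (Y : C) (f : hom Y X), S Y f -> restr F f x = restr F f y) -> x = y.
Proof.
intros HS x y Hxy.
destruct (classic (isomorphic X o)) as [HX | HX].
- destruct (singleton_isomorphic hFo HX) as [z Hz].
  now rewrite (Hz x), (Hz y).
- destruct (hP X S HX HS) as [U [HU HUS]].
  apply (simple_covering_separated U HU); intros i.
  apply Hxy, HUS.
  exists i, (idm _); now rewrite comp_idr.
Qed.

(** The data live on a sieve [S] containing [U], so compatibility needs no fibre products; [S] and
    [s] vary so that the induction can pass to their pullbacks along [p] and [e]. *)
Lemma simple_covering_glue {X : C} (U : family X) :
  simple_covering P U ->
  forall (S : sieve X) (s : forall (Y : C) (f : hom Y X), S Y f -> F Y),
  matching s -> sub_sieve (generated_sieve U) S ->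
  exists x : F X, forall (i : idx U) (Hi : S _ (arr U i)),
    restr F (arr U i) x = s _ (arr U i) Hi.
Proof.
induction 1 as [X Y f [g [Hgf Hfg]] | Q U V HQ HU IHU HV IHV];
  intros S s Hs HUS.
- assert (Hf : S Y f).
  { apply HUS; exists tt, (idm Y); symmetry; apply comp_idr. }
  exists (restr F g (s Y f Hf)); intros i Hi; simpl in *.
  rewrite <- restr_comp, Hgf, restr_id.
  now apply matching_irrelevant.
- assert (SU : sub_sieve (generated_sieve U) (pullback_sieve (sq_p Q) S)).
  { intros Z f [i [g Hg]]; apply HUS; exists (inl i), g; simpl.
    now rewrite Hg, comp_assoc. }
  assert (SV : sub_sieve (generated_sieve V) (pullback_sieve (sq_e Q) S)).
  { intros Z f [j [g Hg]]; apply HUS; exists (inr j), g; simpl.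
    now rewrite Hg, comp_assoc. }
  destruct (IHU _ _ (matching_pullback F (sq_p Q) S s Hs) SU) as [y Hy].
  destruct (IHV _ _ (matching_pullback F (sq_e Q) S s Hs) SV) as [a Ha].
  simpl in Hy, Ha.
  assert (InU : forall i, S _ (sq_p Q ∘ arr U i)).
  { intros i; apply SU; exists i, (idm _); symmetry; apply comp_idr. }
  assert (InV : forall j, S _ (sq_e Q ∘ arr V j)).
  { intros j; apply SV; exists j, (idm _); symmetry; apply comp_idr. }
  assert (Hya : restr F (sq_by Q) y = restr F (sq_ba Q) a).
  (* An arrow to [B] in this meet factors through some [arr U i] over [Y] and some [arr V j] over
     [A]. Both restrictions are then entries of [s] at arrows to [X] that are equal because the
     square commutes. *)
  { apply (covers_separated
      (meet_sieve (pullback_sieve (sq_by Q) (generated_sieve U))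
                  (pullback_sieve (sq_ba Q) (generated_sieve V)))).
    { apply covers_meet; apply covers_pullback;
        now apply simple_covering_covers. }
    intros Z f [[i [g Hg]] [j [h Hh]]].
    rewrite <- !restr_comp, Hg, Hh, !restr_comp, (Hy i (InU i)), (Ha j (InV j)).
    rewrite (Hs _ _ _ _ _ (sieve_closed g (InU i))).
    rewrite (Hs _ _ _ _ _ (sieve_closed h (InV j))).
    apply matching_irrelevant; [exact Hs|].
    now rewrite <- !comp_assoc, <- Hg, <- Hh, !comp_assoc, sq_comm. }
  destruct (pullback_glue _ _ _ _ (hFQ Q HQ) y a Hya) as [x [Hxy Hxa]].
  exists x; intros [i|j] Hk; simpl in *; rewrite restr_comp.
  + rewrite Hxy; apply Hy.
  + rewrite Hxa; apply Ha.
Qed.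

(** For [f] in [S], the generated sieve pulled back along [f] covers. For [g] in it, [f ∘ g] factors
    through [U], so both sections restrict along [g] to the entry of [s] at [f ∘ g]. *)
Lemma glue_amalgamation {X : C} (S : sieve X)
    (s : forall (Y : C) (f : hom Y X), S Y f -> F Y) (U : family X) (x : F X) :
  matching s -> covers (cd_topology o P) (generated_sieve U) ->
  sub_sieve (generated_sieve U) S ->
  (forall (i : idx U) (Hi : S _ (arr U i)),
     restr F (arr U i) x = s _ (arr U i) Hi) ->
  amalgamation s x.
Proof.
intros Hs HU HUS Hx Y f Hf.
apply (covers_separated (pullback_sieve f (generated_sieve U))).
{ now apply covers_pullback. }
intros Z g [i [h Hh]].
assert (Hi : S _ (arr U i)).
{ apply HUS; exists i, (idm _); symmetry; apply comp_idr. }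
rewrite <- restr_comp, Hh, restr_comp, (Hx i Hi).
rewrite (Hs _ _ _ _ _ (sieve_closed g Hf)), (Hs _ _ _ _ _ (sieve_closed h Hi)).
now apply matching_irrelevant.
Qed.

End CdSheaf.

Theorem lemma2p9 (C : category) (o : C) (ho : is_initial o)
    (P : cd_structure C) (hP : complete o P)
    (F : presheaf C) (hFo : is_singleton (F o))
    (hFQ : forall Q : square C, P Q ->
       is_pullback (restr F (sq_p Q)) (restr F (sq_e Q))
                   (restr F (sq_by Q)) (restr F (sq_ba Q))) :
  is_sheaf (cd_topology o P) F.
Proof.
intros X S HS s Hs.
(* Uniqueness is separatedness for [S] itself, which leaves existence. *)
enough (exists x : F X, amalgamation s x) as [x Hx].
{ exists x; split; [exact Hx|]; intros x' Hx'.
  apply (covers_separated hP hFo hFQ S HS); intros Y f Hf.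
  now rewrite (Hx Y f Hf), (Hx' Y f Hf). }
destruct (classic (isomorphic X o)) as [HX | HX].
- destruct (singleton_isomorphic hFo HX) as [x _]; exists x; intros Y f Hf.
  (* [Y] need not be isomorphic to [o], but the empty sieve covers it too. *)
  apply (covers_separated hP hFo hFQ (pullback_sieve f (empty_sieve X))).
  + now apply covers_pullback, empty_sieve_covers_isomorphic.
  + now intros Z g Hg.
- destruct (hP X S HX HS) as [U [HU HUS]].
  destruct (simple_covering_glue hP hFo hFQ U HU S s Hs HUS) as [x Hx].
  exists x; apply (glue_amalgamation hP hFo hFQ S s U); try assumption.
  now apply simple_covering_covers.
Qed.
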